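(* Let $U\subset P(m)$ be a shifted order ideal and let $0\le t\le d_{\max}(U)$. Then the $h$-vector of the squeezed complex $\Delta_t(U)$ satisfies, for all $0\le i\le d_{\max}(U)+t$, $$h_i(\Delta_t(U))=\#\{u\in U : \deg(u)=i\}.$$
   Context: Notation. $\mathbb{K}$ is a field, $m\ge 1$, $P(m)=\mathbb{K}[x_1,\ldots,x_m]$; $[n]=\{1,\ldots,n\}$ and $[a,b]=\{c\in\mathbb{N} : a\le c\le b\}$ (empty if $a>b$). Order ideals. A monomial order ideal of $P(m)$ is a finite set $U$ of monomials of $P(m)$ closed under taking divisors; it is always assumed that $1,x_1,\ldots,x_m\in U$. $U$ is shifted if $x_iu\in U$ ($u$ a monomial) and $i<j\le m$ imply $x_ju\in U$. $d_{\max}(U)$ is the maximal degree of a monomial in $U$. Squeezed complexes. Put $d=d_{\max}(U)$ and let $t\ge 0$ be an integer. For $u=x_{i_1}\cdots x_{i_s}\in U$ with $i_1\le\cdots\le i_s$ set $$F_t(u)=\bigcup_{\ell=1}^s\{i_\ell+2(\ell-1),\,i_\ell+2\ell-1\}\cup[m+2s+1,\,m+t+d]\quad\text{if } s\le t,$$ $$F_t(u)=\bigcup_{\ell=1}^t\{i_\ell+2(\ell-1),\,i_\ell+2\ell-1\}\cup\bigcup_{\ell=t+1}^s\{i_\ell+\ell+t-1\}\cup[m+t+s+1,\,m+t+d]\quad\text{if } s\ge t.$$ Each $F_t(u)$ is a $(d+t)$-subset of $[m+t+d]$. $\Delta_t(U)$ is the pure $(d+t-1)$-dimensional simplicial complex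 on vertex set $[m+t+d]$ whose facets are the sets $F_t(u)$, $u\in U$. $h$-vector. For an $(e-1)$-dimensional simplicial complex $\Delta$ with $f_i(\Delta)$ faces of dimension $i$, the $h$-vector $(h_0(\Delta),\ldots,h_e(\Delta))$ is defined by $\sum_{i=0}^{e}f_{i-1}(\Delta)(z-1)^{e-i}=\sum_{i=0}^{e}h_i(\Delta)z^{e-i}$. *)

(* Defs.v *)
From mathcomp Require Import all_boot all_order all_algebra.
From mathcomp Require Import finmap mpoly.

Set Implicit Arguments.
Unset Strict Implicit.
Unset Printing Implicit Defensive.

Import GRing.Theory.

Local Open Scope nat_scope.
Local Open Scope fset_scope.

(* A monomial of K[x_1, ..., x_m] is its exponent vector, of type 'X_{1..m};
   this is the type of the monomials of {mpoly K[m]} for every field K.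
   The variable x_(j + 1) is U_(j), for j : 'I_m. *)

Definition order_ideal (m : nat) (U : {fset 'X_{1..m}}) : Prop :=
  [/\ forall u v : 'X_{1..m}, u \in U -> (v <= u)%MM -> v \in U,
      0%MM \in U
    & forall i : 'I_m, U_(i)%MM \in U].

Definition shifted (m : nat) (U : {fset 'X_{1..m}}) : Prop :=
  forall (u : 'X_{1..m}) (i j : 'I_m),
    i < j -> (U_(i) + u)%MM \in U -> (U_(j) + u)%MM \in U.

Definition dmax (m : nat) (U : {fset 'X_{1..m}}) : nat :=
  \max_(u <- U) mdeg u.

(* [mon_index u l] is i_l, where u = x_(i_1) ... x_(i_s) with
   i_1 <= ... <= i_s and 1 <= l <= s; [m2s u] is the nondecreasing sequence of
   the variables of u with multiplicity, numbered from 0. *)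
Definition mon_index (m : nat) (u : 'X_{1..m}) (l : nat) : nat :=
  nth 0 [seq (val i).+1 | i <- m2s u] l.-1.

Definition nat_interval (a b : nat) : {fset nat} :=
  [fset c in index_iota a b.+1].

Definition squeezed_facet (m d t : nat) (u : 'X_{1..m}) : {fset nat} :=
  let s := mdeg u in
  let i := mon_index u in
  if s <= t then
    (\bigcup_(l <- index_iota 1 s.+1)
        [fset (i l + 2 * (l - 1))%N; (i l + 2 * l - 1)%N])
      `|` nat_interval (m + 2 * s + 1)%N (m + t + d)%N
  else
    (\bigcup_(l <- index_iota 1 t.+1)
        [fset (i l + 2 * (l - 1))%N; (i l + 2 * l - 1)%N])
      `|` (\bigcup_(l <- index_iota t.+1 s.+1) [fset (i l + l + t - 1)%N])
      `|` nat_interval (m + t + s + 1)%N (m + t + d)%N.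

(* A simplicial complex is given by the set of all its faces, including the
   empty one. *)
Definition squeezed_complex (m t : nat) (U : {fset 'X_{1..m}}) :
    {fset {fset nat}} :=
  \bigcup_(u <- U) fpowerset (squeezed_facet (dmax U) t u).

Section HVector.

Variables (V : choiceType) (D : {fset {fset V}}).

(* One more than the dimension of D. *)
Definition complex_rank : nat := \max_(F <- D) #|` F|.

(* [nfaces k] is f_(k-1)(D). *)
Definition nfaces (k : nat) : nat := #|` [fset F in D | #|` F| == k]|.

Definition h_poly : {poly int} :=
  (\sum_(i < complex_rank.+1)
    ('X - 1) ^+ (complex_rank - i) *+ nfaces i)%R.

(* The entries are h_vector 0, ..., h_vector complex_rank; beyond this range
   the value is 0. *)
Definition h_vector (i : nat) : int :=
  if i <= complex_rank then (h_poly`_(complex_rank - i))%R else 0%R.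

End HVector.

(* Main.v *)
Require Import Defs.
From mathcomp Require Import all_boot all_order all_algebra.
From mathcomp Require Import finmap mpoly.
From mathcomp Require Import zify.

(** Homogenize the monomials of U to degree d = dmax U with an extra variable
    x_(m + 1).  The indices i_1 <= ... <= i_d of the homogenized monomial u then
    give the facet F(u) uniformly, as a union of d disjoint blocks: the l-th
    block starts at i_l + 2 (l - 1) and has two elements if l <= t, and is the
    point i_l + l + t - 1 otherwise.  Let R(u) consist of the starts of the
    first deg u blocks, those of the true variables of u.  The claim is that
    the faces of the complex are partitioned by the intervals [R(u), F(u)], u in
    U.  Such a partition determines the h-polynomial: the interval of u
    contributes the sum of (z - 1)^(|F(u)| - |G|) over R(u) <= G <= F(u), which
    is z^(|F(u)| - |R(u)|) by the binomial theorem, so h_i counts the u with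
    |R(u)| = deg u = i ([h_vector_partitionable]).

    Every face lies in an interval ([exists_restriction]).  Suppose that the
    face G is contained in F(u) but misses the start of the l-th block, where
    i_l <= m.  Replacing all the indices i_k = i_l with k >= l by i_l + 1 keeps
    the monomial in U, because U is shifted (and closed under divisors, when
    i_l = m).  The blocks of these indices are consecutive and fill an integer
    interval; the replacement slides this interval by one, so that only its
    first element, which G misses, is lost ([block_union_raise]).  Since indices
    grow, this stops.

    The intervals are disjoint ([starts_sub_inj]).  If G lies in those of u and
    of v, then R(u) <= F(v) and R(v) <= F(u).  The gap between the l-th element
    of R(u) and the next is at least the size of the l-th block of F(v), so
    inductively the l-th element of R(u) lies in the l-th block of F(v) or
    later ([starts_sub_leq]): the indices of u dominate those of v, and by
    symmetry u = v. *)

Set Implicit Arguments.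
Unset Strict Implicit.
Unset Printing Implicit Defensive.

Import GRing.Theory.

Local Open Scope fset_scope.
Local Open Scope nat_scope.

(** * The h-vector of a partitionable complex *)

Section Partitionable.

Variable V : choiceType.
Implicit Types (A B G : {fset V}) (D : {fset {fset V}}).

(** The binomial theorem, by induction on A: splitting the subsets according to
    a new element multiplies the sum by y + 1. *)
Lemma sum_subsets_exp (S : comNzRingType) (y : S) A :
  (\sum_(G <- fpowerset A) y ^+ (#|` A| - #|` G|) = (y + 1) ^+ #|` A|)%R.
Proof.
elim/fset1U_rect: A => [|x A xA IH].
  by rewrite fpowerset0 big_seq_fset1 cardfs0 subnn !expr0.
have memx B : B `<=` A -> x \notin B.
  by move=> /fsubsetP sBA; apply: contra xA; apply: sBA.
pose P2 := [fset x |` B | B in fpowerset A].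
have inj2 : {in fpowerset A &, injective (fun B => x |` B)}.
  move=> B C; rewrite !fpowersetE => /memx xB /memx xC eqBC.
  by rewrite -(fsetU1K xB) eqBC fsetU1K.
have /(perm_big _) -> /= : perm_eq (fpowerset (x |` A)) (fpowerset A ++ P2).
  apply: uniq_perm; rewrite ?fset_uniq // ?cat_uniq ?fset_uniq /= ?andbT //.
    apply/hasPn => B /imfsetP[C /= _ ->]; rewrite fpowersetE.
    by apply/negP=> /fsubsetP/(_ x); rewrite !inE eqxx (negPf xA) => /(_ isT).
  move=> B; rewrite mem_cat fpowersetE; apply/idP/orP.
    move=> sB; have [xB|xB] := boolP (x \in B); last first.
      left; rewrite fpowersetE; apply/fsubsetP => z zB.
      have := fsubsetP sB z zB; rewrite !inE => /orP[/eqP zx|//].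
      by rewrite -zx zB in xB.
    right; apply/imfsetP; exists (B `\ x); rewrite ?fsetD1K //=.
    rewrite fpowersetE; apply/fsubsetP => z; rewrite !inE => /andP[zx zB].
    by have := fsubsetP sB z zB; rewrite !inE (negPf zx).
  case=> [|/imfsetP[C /= + ->]]; rewrite fpowersetE => sBA.
    exact: fsubset_trans sBA (fsubsetUr _ _).
  exact: fsetUS.
rewrite big_cat /=.
have -> : (\sum_(B <- P2) y ^+ (#|` x |` A| - #|` B|)
    = \sum_(B <- fpowerset A) y ^+ (#|` x |` A| - #|` x |` B|))%R.
  by rewrite big_imfset.
rewrite cardfsU1 xA add1n exprS mulrDl mul1r -IH mulr_sumr; congr (_ + _)%R.
  rewrite big_seq [RHS]big_seq; apply: eq_bigr => B; rewrite fpowersetE => sBA.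
  by rewrite subSn ?exprS // fsubset_leq_card.
rewrite big_seq [RHS]big_seq; apply: eq_bigr => B; rewrite fpowersetE => sBA.
by rewrite cardfsU1 (memx _ sBA).
Qed.

Lemma h_poly_faces D :
  h_poly D = (\sum_(G <- D) ('X - 1) ^+ (complex_rank D - #|` G|))%R.
Proof.
rewrite /h_poly [RHS]big_seq.
have rk G : G \in D -> #|` G| < (complex_rank D).+1.
  move=> GD; rewrite ltnS /complex_rank.
  exact: (leq_bigmax_seq (F := fun G => #|` G|)).
pose rank G : 'I_(complex_rank D).+1 := inord #|` G|.
rewrite (partition_big rank xpredT) //=.
apply: eq_bigr => k _.
rewrite (eq_bigr (fun=> ('X - 1) ^+ (complex_rank D - k)))%R; last first.
  by move=> G /andP[GD /eqP <-]; rewrite inordK ?rk.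
rewrite -big_seq_cond /nfaces big_const_seq iter_addr_0; congr (_ *+ _)%R.
rewrite -size_filter.
apply/perm_size/uniq_perm; rewrite ?filter_uniq ?fset_uniq //.
move=> G; rewrite !inE mem_filter andbC; case GD: (G \in D) => /=.
  by rewrite -val_eqE /= inordK ?rk.
by rewrite !andbF.
Qed.

Variables (I : choiceType) (U : {fset I}) (R F : I -> {fset V}) (e : nat).

(** The last two hypotheses say that the intervals [R u, F u] cover the faces
    and are disjoint; disjointness takes this form because a common face G
    satisfies R u <= G <= F v and R v <= G <= F u.  Summing over each interval
    with [sum_subsets_exp] at y = z - 1 turns the h-polynomial into the sum of
    the monomials z^(e - |R u|). *)
Lemma h_vector_partitionable :
    (exists u, u \in U) ->
    {in U, forall u, R u `<=` F u} -> {in U, forall u, #|` F u| = e} ->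
    {in U, forall u G, G `<=` F u ->
       exists2 v, v \in U & (R v `<=` G) && (G `<=` F v)} ->
    {in U &, forall u v, R u `<=` F v -> R v `<=` F u -> u = v} ->
  forall i, i <= e ->
    h_vector (\bigcup_(u <- U) fpowerset (F u)) i =
    Posz #|` [fset u in U | #|` R u| == i]|.
Proof.
move=> [u0 u0U] RF cF ex uniq_int i ie.
set D := \bigcup_(u <- U) _.
have DP G : reflect (exists2 u, u \in U & G `<=` F u) (G \in D).
  apply: (iffP (@bigfcupP _ _ _ _ _ _)) => [[u /andP[uU _]]|[u uU GF]].
    by rewrite fpowersetE; exists u.
  by exists u; rewrite ?uU // fpowersetE.
have rkD : complex_rank D = e.
  apply/eqP; rewrite eqn_leq; apply/andP; split.
    apply/bigmax_leqP_seq => G /DP[u uU GF] _.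
    by rewrite -(cF u uU) fsubset_leq_card.
  rewrite -(cF u0 u0U) /complex_rank (leq_bigmax_seq (F := fun G => #|` G|)) //.
  by apply/DP; exists u0.
(* The contribution of one interval, whose faces are R u plus a subset of
   F u minus R u. *)
have intE u : u \in U ->
    (\sum_(G <- D | (R u `<=` G) && (G `<=` F u)) ('X - 1) ^+ (e - #|` G|)
     = 'X ^+ (e - #|` R u|) :> {poly int})%R.
  move=> uU; have cRF := cardfsD (F u) (R u).
  rewrite (fsetIidPr (RF u uU)) cF // in cRF.
  have := sum_subsets_exp ('X - 1 : {poly int})%R (F u `\` R u).
  rewrite subrK cRF => <-.
  have disjK B : B `<=` F u `\` R u -> (R u `|` B) `\` R u = B.
    by rewrite fsubsetD fsetDUl fsetDv fset0U => /andP[_ /fsetDidPl].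
  have inj : {in fpowerset (F u `\` R u) &, injective (fun B => R u `|` B)}.
    move=> B C; rewrite !fpowersetE => sB sC /(congr1 (fun X => X `\` R u)).
    by rewrite !disjK.
  transitivity (\sum_(G <- [fset R u `|` B | B in fpowerset (F u `\` R u)])
      ('X - 1) ^+ (e - #|` G|) : {poly int})%R.
    rewrite -big_filter.
    apply/perm_big/uniq_perm; rewrite ?filter_uniq ?fset_uniq //.
    move=> G; rewrite mem_filter; apply/andP/imfsetP => /= [[/andP[RG GF] _]|].
      exists (G `\` R u); first by rewrite fpowersetE fsetSD.
      by rewrite fsetUDl fsetDv fsetD0; apply/esym/fsetUidPr.
    case=> B; rewrite fpowersetE fsubsetD => /andP[BF _] ->.
    have sF : R u `|` B `<=` F u by rewrite fsubUset RF.
    by split; [rewrite fsubsetUl | apply/DP; exists u].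
  rewrite big_imfset //=; apply: eq_big_seq => B; rewrite fpowersetE fsubsetD.
  move=> /andP[_ dB]; congr (_ ^+ _)%R; rewrite cardfsU.
  rewrite fsetIC (_ : B `&` R u = fset0) ?cardfs0; first by lia.
  exact/eqP.
rewrite /h_vector rkD ie h_poly_faces rkD.
rewrite (_ : \sum_(G <- D) _ = \sum_(u <- U) 'X ^+ (e - #|` R u|))%R; last first.
  rewrite (eq_big_seq _ (fun u uU => esym (intE u uU))).
  rewrite (exchange_big_dep xpredT) //=; apply: eq_big_seq => G /DP[u uU GF].
  have [v vU /andP[RG GFv]] := ex u uU G GF.
  rewrite big_mkcond (big_fsetD1 v) //= RG GFv /= big1_seq ?addr0 //.
  move=> w /=; rewrite !inE => /andP[wv wU].
  case: ifP => // /andP[RwG GFw].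
  case/eqP: wv; apply: uniq_int => //.
    exact: fsubset_trans RwG GFv.
  exact: fsubset_trans RG GFw.
(* The truncated subtractions e - i and e - |R u| agree only if i = |R u|, as
   both i and |R u| are at most e. *)
rewrite coef_sum (eq_big_seq (fun u => (#|` R u| == i)%:R))%R; last first.
  move=> u uU; rewrite coefXn; congr (nat_of_bool _)%:R%R.
  by have := fsubset_leq_card (RF u uU); rewrite cF //; lia.
rewrite -natr_sum natz; congr Posz.
rewrite (eq_bigr (fun u => if #|` R u| == i then 1 else 0)); last first.
  by move=> u _; case: eqP.
rewrite -big_mkcond sum1_count -size_filter; apply/perm_size/uniq_perm.
- by rewrite filter_uniq ?fset_uniq.
- exact: fset_uniq.
by move=> u; rewrite mem_filter !inE andbC.
Qed.

End Partitionable.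

(** * Unions of t pairs and d - t points *)

Section Blocks.

Variables (t d : nat).
Implicit Types p q : nat -> nat.

(** The blocks are numbered from 0, so that block l is the pair
    {p l, p l + 1} if l < t and the point p l otherwise; the condition says that
    they are disjoint and increasing. *)
Definition spread p := forall l, p l + 1 + (l < t) <= p l.+1.

Definition starts p s : {fset nat} := [fset p l | l in iota 0 s].

Definition block_union p : {fset nat} :=
  starts p d `|` [fset (p l).+1 | l in iota 0 t].

Lemma startsP p s x :
  reflect (exists2 l, l < s & x = p l) (x \in starts p s).
Proof.
apply: (iffP (imfsetP _ _ _ _)) => -[l ls ->]; exists l => //;
by move: ls; rewrite /= mem_iota.
Qed.

Lemma block_unionP p x : t <= d ->
  reflect (exists2 l, l < d & p l <= x <= p l + (l < t)) (x \in block_union p).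
Proof.
move=> td; rewrite in_fsetU; apply: (iffP orP) => [[/startsP|/imfsetP]|].
- by case=> l ld ->; exists l => //; lia.
- by case=> l /=; rewrite mem_iota => lt ->; exists l; lia.
case=> l ld; have [->|xl] := eqVneq x (p l).
  by left; apply/startsP; exists l.
by right; apply/imfsetP; exists l; rewrite /= ?mem_iota; lia.
Qed.

Lemma spread_ltn p : spread p -> {homo p : k l / k < l}.
Proof. by move=> sp; apply: homo_ltn ltn_trans _ => l; have := sp l; lia. Qed.

Lemma spread_inj p : spread p -> injective p.
Proof.
move=> sp k l eqkl; have := spread_ltn sp (x := k) (y := l).
by have := spread_ltn sp (x := l) (y := k); lia.
Qed.

Lemma card_starts p s : spread p -> #|` starts p s| = s.
Proof.
move=> sp; rewrite card_in_imfset /=.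
  by rewrite undup_id ?iota_uniq // size_iota.
by move=> k l _ _; apply: spread_inj.
Qed.

Lemma card_block_union p : spread p -> t <= d -> #|` block_union p| = d + t.
Proof.
move=> sp td; rewrite cardfsU card_starts //.
rewrite card_in_imfset /=; last by move=> k l _ _ [] /(spread_inj sp).
rewrite undup_id ?iota_uniq // size_iota.
rewrite (_ : _ `&` _ = fset0) ?cardfs0 ?subn0 //.
apply/fsetP => x; rewrite in_fsetI in_fset0.
apply/negP => /andP[/startsP[l ld ->]].
case/imfsetP => k /=; rewrite mem_iota => kt eqlk.
have lt k1 k2 : k1 < k2 -> p k1 < p k2 := spread_ltn sp (x := k1) (y := k2).
move: eqlk; have := sp k.
case: (ltngtP l k) => [/lt|kl|->]; [lia| |lia].
by have [->|] := eqVneq l k.+1; [lia|have := lt k.+1 l; lia].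
Qed.

Lemma starts_sub p s : s <= d -> starts p s `<=` block_union p.
Proof.
move=> sd; apply/fsubsetP => x /startsP[l ls ->]; rewrite in_fsetU; apply/orP.
by left; apply/startsP; exists l => //; lia.
Qed.

(** By induction on l, the block of q containing p l has number at least l: it
    lies beyond the block number l - 1 of q, because q (l - 1) <= p (l - 1) and
    p l - p (l - 1) is at least the size of that block. *)
Lemma starts_sub_leq p q s : spread p -> spread q -> t <= d ->
  starts p s `<=` block_union q -> forall l, l < s -> q l <= p l.
Proof.
move=> sp sq td /fsubsetP sub; have incq k l : k <= l -> q k <= q l.
  by rewrite leq_eqVlt => /predU1P[-> //|/(spread_ltn sq)/ltnW].
elim=> [|l IH] ls.
  have /sub/block_unionP-/(_ td)[k kd] : p 0 \in starts p s.
    by apply/startsP; exists 0.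
  by case: k kd => [|k] kd; [|have := incq 0 k.+1]; lia.
have /sub/block_unionP-/(_ td)[k kd /andP[qp pq]] : p l.+1 \in starts p s.
  by apply/startsP; exists l.+1.
have := IH (ltnW ls); have := sp l.
have := incq l.+1 k; have := incq k.+1 l; have := sq k.
by case: (ltngtP k l) kd qp pq => [?|?|->]; lia.
Qed.

(** The blocks l, ..., l' - 1 of p are adjacent, so their union is an interval
    of integers starting at p l, and raising these starts by one slides it: the
    first element of each block is caught by the raised block before it. *)
Lemma block_union_raise p q l l' : t <= d -> l < l' <= d ->
    (forall k, k < d -> q k = p k + (l <= k < l')) ->
    (forall k, l <= k -> k.+1 < l' -> p k.+1 = p k + 1 + (k < t)) ->
  block_union p `\ p l `<=` block_union q.
Proof.
move=> td ll' qE pE; apply/fsubsetP => x; rewrite in_fsetD1 => /andP[xl].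
case/block_unionP => // k kd kx; apply/block_unionP => //.
have [kl|kl] := boolP (l <= k < l'); last by exists k => //; rewrite qE //; lia.
have [xk|xk] := eqVneq x (p k); last by exists k => //; rewrite qE //; lia.
(* What remains is x = p k with l < k, which block k - 1 of q contains. *)
have [lk|lk] := eqVneq l k; first by rewrite lk xk eqxx in xl.
case: k => [|k] in kd kx kl xk lk *; first by lia.
exists k; first lia.
have lk' : l <= k by lia.
by rewrite qE; [have := pE k lk'|]; lia.
Qed.

End Blocks.

(** * The index sequence of a monomial *)

Section Monomials.

Variable m : nat.
Implicit Types (u v w : 'X_{1..m}) (U : {fset 'X_{1..m}}).

(** The default value m is the homogenizing variable: variables and positions
    are numbered from 0, and every position beyond the degree of u holds m. *)
Definition var_index u l := nth m [seq val i | i <- m2s u] l.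

(** The degree in the first j variables.  These partial sums turn changes of
    exponents into changes of the index sequence, through [leq_var_index]. *)
Definition low_degree u j := \sum_(i < m | i < j) u i.

Lemma low_degree_count u j :
  low_degree u j = count (fun x => x < j) [seq val i | i <- m2s u].
Proof.
rewrite count_map /m2s count_flatten sumnE !big_map /low_degree /=.
rewrite -enumT big_enum /= big_mkcond /=; apply: eq_bigr => i _.
rewrite count_nseq /=.
by case: (i < j); rewrite ?mul1n ?mul0n.
Qed.

Lemma low_degreeD u v j :
  low_degree (u + v) j = low_degree u j + low_degree v j.
Proof. by rewrite -big_split; apply: eq_bigr => i _; rewrite mnmDE. Qed.

Lemma low_degreeMU (i : 'I_m) c j : low_degree (U_(i) *+ c) j = (i < j) * c.
Proof.
rewrite /low_degree big_mkcond (bigD1 i) //= big1 ?addn0.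
  by rewrite mulmnE mnm1E eqxx; case: (i < j); lia.
move=> k ki; rewrite mulmnE mnm1E eq_sym (negPf ki).
by case: (k < j).
Qed.

Lemma low_degreeS u (i : 'I_m) : low_degree u i.+1 = low_degree u i + u i.
Proof.
rewrite /low_degree (bigD1 i) //= addnC; congr (_ + _); apply: eq_bigl => k.
by rewrite -val_eqE /=; lia.
Qed.

Lemma low_degree_inj u v :
  (forall j, j <= m -> low_degree u j = low_degree v j) -> u = v.
Proof.
move=> uv; apply/mnmP => i; have := uv i.+1 (ltn_ord i).
by rewrite !low_degreeS uv ?(ltnW (ltn_ord i)) // => /addnI.
Qed.

(** The first [low_degree u j] positions of the sorted sequence hold the
    variables below j.  The restriction j <= m accounts for the default m. *)
Lemma leq_var_index u j l : j <= m ->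
  (j <= var_index u l) = (low_degree u j <= l).
Proof.
move=> jm; rewrite low_degree_count /var_index.
have [ls|sl] := ltnP l (size [seq val i | i <- m2s u]); last first.
  by rewrite nth_default // jm (leq_trans (count_size _ _)).
have ss : sorted <=%O [seq val i | i <- m2s u] := srt_m2s u.
apply/idP/idP => [|cl]; last first.
  by apply: (Order.TotalTheory.DualTotalTheory.nth_count_ge m ss); rewrite cl.
apply: contraTT; rewrite -!ltnNge.
exact: (Order.POrderTheory.nth_count_lt m ss).
Qed.

Lemma var_index_lt u l : (var_index u l < m) = (l < mdeg u).
Proof.
rewrite -size_m2s -(size_map val) /var_index.
have [ls|sl] := ltnP l _; last by rewrite nth_default // ltnn.
by have /mapP[i _ ->] := mem_nth m ls; apply: ltn_ord.
Qed.

Lemma var_index_le u l : var_index u l <= m.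
Proof.
have := var_index_lt u l; have [_ /ltnW //|sl _] := ltnP l (mdeg u).
by rewrite /var_index nth_default // size_map size_m2s.
Qed.

Lemma var_index_homo u : {homo var_index u : k l / k <= l}.
Proof.
move=> k l kl; rewrite leq_var_index ?var_index_le //.
by apply: leq_trans kl; rewrite -leq_var_index ?var_index_le.
Qed.

Lemma var_index_inj u v : (forall l, var_index u l = var_index v l) -> u = v.
Proof.
move=> uv; apply: low_degree_inj => j jm.
have uv_le l : (low_degree u j <= l) = (low_degree v j <= l).
  by rewrite -!leq_var_index // uv.
by apply/eqP; rewrite eqn_leq uv_le leqnn -uv_le leqnn.
Qed.

Lemma shifted_exp U (i j : 'I_m) c w : shifted U -> i < j ->
  (U_(i) *+ c + w)%MM \in U -> (U_(j) *+ c + w)%MM \in U.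
Proof.
move=> sU ij; have addmCA x y z : (x + (y + z) = y + (x + z) :> 'X_{1..m})%MM.
  by rewrite !addmA [(x + y)%MM]addmC.
elim: c w => [|c IH] w; first by rewrite !mulm0n.
rewrite !mulmS -!addmA addmCA => /IH; rewrite addmCA.
exact: sU.
Qed.

(** The monomial v replaces c copies of x_i by the next variable, or deletes
    them when x_i is the last one; deletion is replacement by the homogenizing
    variable, so both have the same effect on the partial degrees up to m. *)
Lemma exists_raise U u (i : 'I_m) c : order_ideal U -> shifted U -> u \in U ->
    c <= u i ->
  exists2 v, v \in U &
    forall k, k <= m -> low_degree v k = low_degree u k - (k == i.+1) * c.
Proof.
move=> [down _ _] sU uU ci.
pose w := (u - U_(i) *+ c)%MM.
have uE : u = (U_(i) *+ c + w)%MM.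
  rewrite addmC submK //; apply/mnm_lepP => k; rewrite mulmnE mnm1E.
  by case: eqVneq => [<-|]; lia.
have degE k : low_degree u k = ((i < k) * c + low_degree w k)%N.
  by rewrite {1}uE low_degreeD low_degreeMU.
have [im|im] := ltnP i.+1 m; last first.
  exists w; first by apply: down uU _; rewrite uE; apply: lem_addl.
  by move=> k km; rewrite degE; have := ltn_ord i; lia.
exists (U_(Ordinal im) *+ c + w)%MM.
  by apply: (@shifted_exp U i) => //=; rewrite -uE.
by move=> k km; rewrite degE low_degreeD low_degreeMU /=; lia.
Qed.

End Monomials.

(** * The facets of a squeezed complex *)

Section Squeezed.

Variables (m t d : nat).
Implicit Types (u v : 'X_{1..m}) (U : {fset 'X_{1..m}}).

(** With l numbered from 0 and indices from 1, this is i + 2 l for the pairs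
    l < t and i + l + t for the points l >= t. *)
Definition block_start u l := (var_index u l).+1 + l + minn l t.

Lemma block_start_spread u : spread t (block_start u).
Proof.
move=> l; rewrite /block_start.
by have := var_index_homo u (leqnSn l); lia.
Qed.

Lemma mon_indexE u l : l < mdeg u -> mon_index u l.+1 = (var_index u l).+1.
Proof.
move=> lu; rewrite /mon_index /var_index /=.
rewrite (map_comp S val) (nth_map m) // size_map size_m2s //.
Qed.

(** The final interval of a facet consists of the blocks of the homogenizing
    variable, so the two cases of the definition become one. *)
Lemma squeezed_facetE u : t <= d -> mdeg u <= d ->
  squeezed_facet d t u = block_union t d (block_start u).
Proof.
move=> td ud; apply/fsetP => x.
have high l : mdeg u <= l -> var_index u l = m.
  by move=> ul; have := var_index_le u l; have := var_index_lt u l; lia.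
have pairE l : l < mdeg u -> l < t ->
    (x \in [fset mon_index u l.+1 + 2 * (l.+1 - 1);
                 mon_index u l.+1 + 2 * l.+1 - 1])
    = (block_start u l <= x <= block_start u l + (l < t)).
  by move=> lu lt; rewrite !inE mon_indexE // /block_start; lia.
apply/idP/(block_unionP _ _ td).
- rewrite /squeezed_facet; case: leqP => ut; rewrite ?in_fsetU.
    case/orP=> [/bigfcupP[l]|].
      rewrite mem_index_iota andbT; case: l => // l lu; rewrite pairE; try lia.
      by exists l => //; lia.
    rewrite /nat_interval !inE /= mem_index_iota => xI.
    (* Up to m + 2 t the final interval is made of pairs, then of points. *)
    have [xt|tx] := leqP x (m + 2 * t).
      exists ((x - m.+1)./2); first lia.
      by rewrite /block_start high; lia.
    exists (x - m.+1 - t); first lia.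
    by rewrite /block_start high; lia.
  case/orP=> [/orP[]/bigfcupP[l]|].
  + rewrite mem_index_iota andbT; case: l => // l lu; rewrite pairE; try lia.
    by exists l => //; lia.
  + rewrite mem_index_iota andbT inE; case: l => // l lu.
    rewrite mon_indexE; last lia.
    by move=> /eqP->; exists l; rewrite /block_start; lia.
  rewrite /nat_interval !inE /= mem_index_iota => xI.
  exists (x - m.+1 - t); first lia.
  by rewrite /block_start high; lia.
case=> l ld xl; rewrite /squeezed_facet; case: leqP => ut; rewrite ?in_fsetU.
  have [lu|ul] := ltnP l (mdeg u); apply/orP; [left|right].
    apply/bigfcupP; exists l.+1; first by rewrite mem_index_iota; lia.
    by rewrite pairE; lia.
  rewrite /nat_interval !inE /= mem_index_iota.
  by move: xl; rewrite /block_start high //; lia.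
have [lu|ul] := ltnP l (mdeg u); apply/orP; [left|right].
  apply/orP; have [lt|tl] := ltnP l t; [left|right].
    apply/bigfcupP; exists l.+1; first by rewrite mem_index_iota; lia.
    by rewrite pairE.
  apply/bigfcupP; exists l.+1; first by rewrite mem_index_iota; lia.
  by move: xl; rewrite inE mon_indexE // /block_start; lia.
rewrite /nat_interval !inE /= mem_index_iota.
by move: xl; rewrite /block_start high //; lia.
Qed.

(** The positions of x_i are those from [low_degree u i] to
    [low_degree u i.+1 - 1]; the last c of them are raised by one. *)
Lemma var_index_raise u v (i : 'I_m) c : c <= u i ->
    (forall j, j <= m -> low_degree v j = low_degree u j - (j == i.+1) * c) ->
  forall k, var_index v k =
    var_index u k + (low_degree u i.+1 - c <= k < low_degree u i.+1).
Proof.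
move=> cu vE k; have im := ltn_ord i.
have leu j : j <= m -> (j <= var_index u k) = (low_degree u j <= k).
  by move=> jm; rewrite leq_var_index.
have lev j : j <= m ->
    (j <= var_index v k) = (low_degree u j - (j == i.+1) * c <= k).
  by move=> jm; rewrite leq_var_index // vE.
have ua := var_index_le u k; have va := var_index_le v k.
have := low_degreeS u i; set l' := low_degree u i.+1 => l'E.
have := leu _ im; have := lev _ im; rewrite eqxx mul1n -/l' => vi ui.
(* Only the threshold i + 1 tells the two sequences apart. *)
have off j : j <= m ->
    j = i.+1 \/ (j <= var_index v k) = (j <= var_index u k).
  have [->|/negPf ji] := eqVneq j i.+1; first by left.
  by move=> jm; right; rewrite lev // leu // ji mul0n subn0.
have := leu i (ltnW im).
have := off _ ua; have := off _ va.
case: (boolP (l' - c <= k < l')) => kl.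
  have [i2|i2] := ltnP i.+1 m; last by lia.
  by have := off i.+2 i2; lia.
by lia.
Qed.

(** Every failure of R(u) <= G raises indices, that is, lowers some partial
    degree; the sum of the partial degrees is the measure for the induction. *)
Lemma exists_restriction U : t <= d -> order_ideal U -> shifted U ->
    {in U, forall u, mdeg u <= d} ->
  {in U, forall u G, G `<=` block_union t d (block_start u) ->
    exists2 v, v \in U &
      (starts (block_start v) (mdeg v) `<=` G)
        && (G `<=` block_union t d (block_start v))}.
Proof.
move=> td oU sU Ud u uU G; have [n] := ubnP (\sum_(j < m.+1) low_degree u j).
elim: n u uU => // n IH u uU un Gu.
have [RG|/fsubsetPn[x /startsP[l lu ->] lG]] :=
  boolP (starts (block_start u) (mdeg u) `<=` G).
  by exists u => //; rewrite RG.
have im : var_index u l < m by rewrite var_index_lt.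
(* Raise all the positions from l to l' - 1, the last one that holds i. *)
pose i := Ordinal im; set l' := low_degree u i.+1.
have il : low_degree u i <= l by rewrite -leq_var_index // ltnW.
have ll' : l < l' by rewrite ltnNge -leq_var_index // ltnn.
have l'd : l' <= d.
  apply: leq_trans (Ud u uU); rewrite -leq_var_index //.
  by have := var_index_lt u (mdeg u); have := ltn_ord i; rewrite ltnn; lia.
have l'E := low_degreeS u i.
have ci : l' - l <= u i by rewrite /l'; lia.
have [v vU vE] := exists_raise oU sU uU ci.
have vi k : var_index v k = var_index u k + (l <= k < l').
  by rewrite (var_index_raise ci vE) -/l'; congr (_ + _); lia.
apply: IH vU _ _.
  apply: leq_trans (_ : \sum_(j < m.+1) low_degree u j <= n); last by lia.
  pose j0 : 'I_m.+1 := Ordinal (im : i.+1 < m.+1).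
  rewrite (bigD1 j0) //= [X in _ < X](bigD1 j0) //= -addSn leq_add //.
    by rewrite vE // eqxx -/l'; lia.
  by apply: leq_sum => j _; rewrite vE ?leq_subr // -ltnS.
have: G `<=` block_union t d (block_start u) `\ block_start u l.
  by rewrite fsubsetD1 Gu.
move/fsubset_trans; apply; apply: (@block_union_raise _ _ _ _ _ l').
- exact: td.
- by rewrite ll'.
- by move=> k _; rewrite /block_start vi; lia.
move=> k lk kl'.
have vk k' : l <= k' < l' -> var_index u k' = i.
  move=> /andP[lk' kl]; apply/eqP; rewrite eqn_leq leq_var_index ?(ltnW im) //.
  by rewrite (leq_trans il lk') andbT leqNgt leq_var_index // -ltnNge.
by rewrite /block_start !vk; lia.
Qed.

(** Each inclusion makes the indices of one monomial dominate those of the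
    other; beyond the degree this is automatic, the homogenizing index being the
    largest. *)
Lemma starts_sub_inj u v : t <= d ->
    starts (block_start u) (mdeg u) `<=` block_union t d (block_start v) ->
    starts (block_start v) (mdeg v) `<=` block_union t d (block_start u) ->
  u = v.
Proof.
move=> td; have le u' v' :
    starts (block_start u') (mdeg u') `<=` block_union t d (block_start v') ->
    forall l, var_index v' l <= var_index u' l.
  move=> sub l; have [lu|ul] := ltnP l (mdeg u').
    have := starts_sub_leq (block_start_spread u') (block_start_spread v')
      td sub lu.
    by rewrite /block_start; lia.
  by have := var_index_le v' l; have := var_index_lt u' l; lia.
move=> /le uv /le vu; apply: var_index_inj => l.
by apply/eqP; rewrite eqn_leq uv vu.
Qed.

End Squeezed.

Theorem corollary3p9 (m : nat) (hm : 1 <= m) (U : {fset 'X_{1..m}})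
    (hU : order_ideal U) (hS : shifted U) (t : nat) (ht : t <= dmax U)
    (i : nat) (hi : i <= dmax U + t) :
  h_vector (squeezed_complex t U) i
    = Posz (#|` [fset u in U | mdeg u == i]|)%fset.
Proof.
have Ud : {in U, forall u, mdeg u <= dmax U}.
  by move=> u uU; rewrite /dmax (leq_bigmax_seq (F := fun u => mdeg u)).
have := block_start_spread (m := m) t => sp.
rewrite /squeezed_complex.
pose facet (u : 'X_{1..m}) := block_union t (dmax U) (block_start t u).
pose restriction (u : 'X_{1..m}) := starts (block_start t u) (mdeg u).
rewrite (eq_big_seq (fun u => fpowerset (facet u))); last first.
  by move=> u uU; rewrite squeezed_facetE // Ud.
rewrite (@h_vector_partitionable _ _ U restriction _ (dmax U + t)) //.
- by congr (Posz #|` _|); apply/fsetP => u; rewrite !inE (card_starts _ (sp u)).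
- by case: hU => _ U0 _; exists 0%MM.
- by move=> u uU; apply: starts_sub; apply: Ud.
- by move=> u uU; apply: card_block_union.
- exact: exists_restriction.
by move=> u v _ _; apply: starts_sub_inj.
Qed.
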